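(* Let $k_x,k_y\ge0$ with $k=k_x+k_y\ge1$, let $m\le2^k$, and let the $m$ valid sites be coordinate-indexed in row-major order by $k$-bit labels as in the context. Let $\widetilde d(s,t)=|x_s-x_t|+|y_s-y_t|$ be the extension of the Manhattan distance to all pairs of $k$-bit labels obtained by letting every unused label be the (virtual) grid point given by its coordinate bits. Then $\widetilde d$ agrees with the Manhattan distance on all pairs of valid sites, its Walsh expansion has $O(2^{k_x}+2^{k_y})$ nonzero coefficients, and its independent-parity CX cost (per net) is $O\big(k(2^{k_x}+2^{k_y})\big)$. In particular, for balanced binary rectangles ($m=2^k$ sites with $|k_x-k_y|\le1$) there are $O(\sqrt m)$ nonzero coefficients and the independent-parity CX cost is $O(k\sqrt m)$ per net. All implied constants are absolute.
   Context: Coordinate-indexed arrays. A $k$-bit label $s\in\{0,\dots,2^k-1\}$ with $k=k_x+k_y$ encodes unsigned coordinates by its bits: the low $k_x$ bits give $x_s\in\{0,\dots,2^{k_x}-1\}$ and the high $k_y$ bits give $y_s\in\{0,\dots,2^{k_y}-1\}$, i.e. $s=x_s+2^{k_x}y_s$. The valid sites are the prefix $\{0,\dots,m-1\}$ of this binary-capacity rectangle, and the Manhattan distance of sites $s,t$ is $|x_s-x_t|+|y_s-y_t|$. Walsh expansion. A real function $g$ of two $k$-bit labels $(s,t)$ has the unique expansion $g(s,t)=\sum_{j=0}^{2^{2k}-1}c_j(-1)^{\mathrm{popcount}(z\,\&\,j)}$, $z=s+2^kt$, where $\&$ is bitwise AND and popcount counts set bits. Independent-parity CX cost. Each Walsh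 term with $j\neq0$ and $c_j\ne0$ is implemented separately by computing the parity of its $\mathrm{popcount}(j)$ qubits onto one of them with CX (controlled-NOT) gates, rotating, and uncomputing, at a cost of $2(\mathrm{popcount}(j)-1)$ CX gates; the independent-parity CX cost is the sum of these numbers over all such $j$. A net is one pair of registers carrying such a distance phase, so the cost for one function $\widetilde d$ is the cost per net. *)

(* Defs.v *)
(* Mathematical Components; the real numbers are an arbitrary [R : realType]. *)
From Stdlib Require PeanoNat.
From HB Require Import structures.
From mathcomp Require Import all_boot all_order all_algebra.
From mathcomp Require Import reals.

Set Implicit Arguments.
Unset Strict Implicit.
Unset Printing Implicit Defensive.

Import Order.TTheory GRing.Theory Num.Theory.

Local Open Scope ring_scope.

(* The bit of weight [2 ^ i]. *)
Definition bit (n i : nat) : bool := Nat.testbit n i.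
Arguments bit : simpl never.

(* The bits of weight [2 ^ i] with [n <= i] are zero, since [n < 2 ^ n]. *)
Definition popcount (n : nat) : nat := (\sum_(i < n) bit n i)%N.

Definition xcoord (kx s : nat) : nat := (\sum_(i < kx) bit s i * 2 ^ i)%N.

Definition ycoord (kx ky s : nat) : nat :=
  (\sum_(i < ky) bit s (kx + i) * 2 ^ i)%N.

(* Grid points are pairs (column, row). *)
Definition label_point (kx ky s : nat) : nat * nat :=
  (xcoord kx s, ycoord kx ky s).

(* The [i]-th site of a grid filled row by row, with rows of length [2 ^ kx]. *)
Definition site_point (kx i : nat) : nat * nat :=
  ((i %% 2 ^ kx)%N, (i %/ 2 ^ kx)%N).

Lemma odd_natE n : Nat.odd n = odd n.
Proof.
suff: Nat.odd n = odd n /\ Nat.odd n.+1 = odd n.+1 by case.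
by elim: n => // n [E1 E2]; split=> //; rewrite /= negbK -E1.
Qed.

Lemma div2_natE n : Nat.div2 n = n./2.
Proof.
suff: Nat.div2 n = n./2 /\ Nat.div2 n.+1 = n.+1./2 by case.
by elim: n => // n [E1 E2]; split=> //; rewrite /= E1.
Qed.

Lemma bit0E n : bit n 0 = odd n.
Proof. exact: odd_natE. Qed.

Lemma bitS n i : bit n i.+1 = bit n./2 i.
Proof. by rewrite /bit /= div2_natE. Qed.

Lemma bitE n i : bit n i = odd (n %/ 2 ^ i).
Proof.
elim: i n => [|i IH] n; first by rewrite bit0E expn0 divn1.
by rewrite bitS IH -divn2 -divnMA -expnS.
Qed.

Lemma bit_small n w i : (n < 2 ^ w)%N -> (w <= i)%N -> bit n i = false.
Proof.
move=> hn hi; rewrite bitE divn_small //.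
by apply: leq_trans hn _; rewrite leq_exp2l.
Qed.

Lemma bit_land z j i : bit (Nat.land z j) i = bit z i && bit j i.
Proof. exact: PeanoNat.Nat.land_spec. Qed.

Lemma popcount_sum n w : (forall i, (w <= i)%N -> bit n i = false) ->
  popcount n = (\sum_(i < w) bit n i)%N.
Proof.
move=> hw; have E a b : (forall i, (a <= i)%N -> bit n i = false) ->
    (a <= b)%N -> (\sum_(0 <= i < b) bit n i = \sum_(0 <= i < a) bit n i)%N.
  move=> ha hab; rewrite (big_cat_nat (leq0n a) hab) /=.
  rewrite [X in (_ + X)%N]big_nat_cond [X in (_ + X)%N]big1 ?addn0 //.
  by move=> i /andP[/andP[hi _] _]; rewrite ha.
rewrite /popcount -!(big_mkord predT (fun i => bit n i : nat)).
rewrite -(E n (maxn n w)) ?leq_maxl // -?(E w (maxn n w)) ?leq_maxr //.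
by move=> i; apply: bit_small; apply: ltn_expl.
Qed.

Lemma coords_label kx ky s : (s < 2 ^ (kx + ky))%N ->
  s = (xcoord kx s + 2 ^ kx * ycoord kx ky s)%N.
Proof.
have H w n : (n < 2 ^ w)%N -> (\sum_(i < w) bit n i * 2 ^ i = n)%N.
  elim: w n => [|w IH] n hn.
    by rewrite big_ord0; case: n hn.
  rewrite big_ord_recl /= bit0E expn0 muln1.
  under eq_bigr => i _ do
    rewrite /bump /= add1n bitS expnS mulnCA.
  rewrite -big_distrr /= IH ?mul2n ?odd_double_half //.
  by rewrite -divn2 ltn_divLR // mulnC -expnS.
move=> hs; rewrite -[LHS](H (kx + ky)%N) // big_split_ord /= /xcoord /ycoord.
congr addn; rewrite big_distrr; apply: eq_bigr => i _ /=.
by rewrite expnD mulnCA.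
Qed.

Section Walsh.
Variable R : realType.

Definition manhattan (p q : nat * nat) : R :=
  `|p.1%:R - q.1%:R| + `|p.2%:R - q.2%:R|.

Definition ext_dist (kx ky : nat) (s t : 'I_(2 ^ (kx + ky))) : R :=
  manhattan (label_point kx ky s) (label_point kx ky t).

Definition walsh_char (z j : nat) : R := (-1) ^+ popcount (Nat.land z j).

Definition walsh_expansion (k : nat) (g : 'I_(2 ^ k) -> 'I_(2 ^ k) -> R)
    (c : {ffun 'I_(2 ^ (2 * k)) -> R}) : bool :=
  [forall s, forall t,
     g s t == \sum_(j < 2 ^ (2 * k)) c j * walsh_char (s + 2 ^ k * t) j].

Let psi n z j : R := (-1) ^+ (\sum_(i < n) (bit z i && bit j i))%N.

Let walsh_charE n z j : (j < 2 ^ n)%N -> walsh_char z j = psi n z j.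
Proof.
move=> hj; rewrite /walsh_char (@popcount_sum _ n); last first.
  by move=> i hi; rewrite bit_land (bit_small hj hi) andbF.
by congr (_ ^+ _); apply: eq_bigr => i _; rewrite bit_land.
Qed.

Let psiS n z j : psi n.+1 z j = (-1) ^+ (odd z && odd j) * psi n z./2 j./2.
Proof.
rewrite /psi big_ord_recl exprD !bit0E; congr (_ * _ ^+ _).
by apply: eq_bigr => i _; rewrite !bitS.
Qed.

Let sum_double m (F : nat -> R) :
  \sum_(0 <= j < m.*2) F j = \sum_(0 <= j < m) (F j.*2 + F j.*2.+1).
Proof.
elim: m => [|m IH]; first by rewrite !big_nil.
by rewrite doubleS !big_nat_recr //= IH addrA.
Qed.

Let psi_orth n z z' : (z < 2 ^ n)%N -> (z' < 2 ^ n)%N ->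
  \sum_(0 <= j < 2 ^ n) psi n z j * psi n z' j = (2 ^ n)%:R * (z == z')%:R.
Proof.
elim: n z z' => [|n IH] z z' hz hz'.
  move: hz hz'; rewrite expn0 !ltnS !leqn0 => /eqP -> /eqP ->.
  by rewrite big_nat1 /psi !big_ord0 !expr0 !mulr1.
have half u : (u < 2 ^ n.+1)%N -> (u./2 < 2 ^ n)%N.
  by move=> hu; rewrite -divn2 ltn_divLR // mulnC -expnS.
rewrite expnS mul2n sum_double.
transitivity ((1 + (-1) ^+ (odd z + odd z')) *
    \sum_(0 <= j < 2 ^ n) psi n z./2 j * psi n z'./2 j).
  rewrite big_distrr; apply: eq_bigr => j _ /=.
  rewrite !psiS /= !odd_double !andbF !andbT !expr0 !mul1r uphalf_double.
  by rewrite !doubleK mulrDl mul1r exprD mulrACA.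
rewrite IH ?half //.
have -> : (z == z') = (odd z == odd z') && (z./2 == z'./2).
  apply/eqP/andP => [-> //|[/eqP ho /eqP hh]].
  by rewrite -[z]odd_double_half ho hh odd_double_half.
rewrite -mul2n natrM; case: (odd z); case: (odd z') => /=.
- by rewrite -signr_odd /= expr0 mulrA.
- by rewrite expr1 subrr mul0r mulr0.
- by rewrite expr1 subrr mul0r mulr0.
- by rewrite expr0 mulrA.
Qed.

Let walsh_charC z j : walsh_char z j = walsh_char j z.
Proof. by rewrite /walsh_char PeanoNat.Nat.land_comm. Qed.

Let walsh_orth n (z z' : 'I_(2 ^ n)) :
  \sum_(j < 2 ^ n) walsh_char z j * walsh_char z' j = (2 ^ n)%:R * (z == z')%:R.
Proof.
rewrite -(psi_orth (ltn_ord z) (ltn_ord z')) big_mkord.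
by apply: eq_bigr => j _; rewrite !(walsh_charE _ (ltn_ord j)).
Qed.

Let split_index k (z : nat) : (z < 2 ^ (2 * k))%N ->
  exists s t : 'I_(2 ^ k), z = (s + 2 ^ k * t)%N.
Proof.
move=> hz; have hs : (z %% 2 ^ k < 2 ^ k)%N by rewrite ltn_pmod ?expn_gt0.
have ht : (z %/ 2 ^ k < 2 ^ k)%N.
  by rewrite ltn_divLR ?expn_gt0 // -expnD addnn -mul2n.
by exists (Ordinal hs), (Ordinal ht); rewrite /= addnC mulnC -divn_eq.
Qed.

Let merge_index k (s t : 'I_(2 ^ k)) : (s + 2 ^ k * t < 2 ^ (2 * k))%N.
Proof.
rewrite mul2n -addnn expnD; apply: (@leq_trans (2 ^ k + 2 ^ k * t)).
  by rewrite ltn_add2r.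
by rewrite -mulnS leq_mul2l ltn_ord orbT.
Qed.

Let pow2_neq0 n : (2 ^ n)%:R != 0 :> R.
Proof. by rewrite pnatr_eq0 expn_eq0. Qed.

Lemma walsh_expansion_exists k (g : 'I_(2 ^ k) -> 'I_(2 ^ k) -> R) :
  exists c, walsh_expansion g c.
Proof.
pose idx s t : 'I_(2 ^ (2 * k)) := Ordinal (@merge_index k s t).
exists [ffun j : 'I_(2 ^ (2 * k)) => (2 ^ (2 * k))%:R^-1 *
  \sum_(p : 'I_(2 ^ k) * 'I_(2 ^ k)) g p.1 p.2 * walsh_char (idx p.1 p.2) j].
apply/forallP => s; apply/forallP => t; apply/eqP; symmetry.
under eq_bigr => j _ do rewrite ffunE -mulrA big_distrl.
rewrite -big_distrr exchange_big /=.
under eq_bigr => p _ do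
  (under eq_bigr => j _ do rewrite -mulrA;
   rewrite -big_distrr /= (walsh_orth (idx p.1 p.2) (idx s t))).
rewrite (bigD1 (s, t)) //= eqxx mulr1 big1 ?addr0.
  by rewrite mulrCA mulVf ?mulr1.
case=> a b /= neq; case: eqP => [/(congr1 val) /= E|_]; last by rewrite !mulr0.
case/negP: neq; apply/eqP; congr pair; apply: val_inj => /=.
  have := congr1 (modn^~ (2 ^ k)%N) E.
  by rewrite /= ![(_ + 2 ^ k * _)%N]addnC ![(2 ^ k * _)%N]mulnC !modnMDl !modn_small.
have := congr1 (divn^~ (2 ^ k)%N) E.
rewrite /= ![(_ + 2 ^ k * _)%N]addnC ![(2 ^ k * _)%N]mulnC.
by rewrite !divnMDl ?expn_gt0 // !divn_small // !addn0.
Qed.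

Lemma walsh_expansion_uniq k (g : 'I_(2 ^ k) -> 'I_(2 ^ k) -> R) c c' :
  walsh_expansion g c -> walsh_expansion g c' -> c = c'.
Proof.
move=> hc hc'; apply/ffunP => i.
have E (z : 'I_(2 ^ (2 * k))) : \sum_(j < 2 ^ (2 * k)) c j * walsh_char z j =
    \sum_(j < 2 ^ (2 * k)) c' j * walsh_char z j.
  have [s [t ->]] := split_index (ltn_ord z).
  move/forallP/(_ s)/forallP/(_ t)/eqP: hc => <-.
  by move/forallP/(_ s)/forallP/(_ t)/eqP: hc' => <-.
have F (d : {ffun 'I_(2 ^ (2 * k)) -> R}) :
    \sum_(z < 2 ^ (2 * k))
      (\sum_(j < 2 ^ (2 * k)) d j * walsh_char z j) * walsh_char z i =
    (2 ^ (2 * k))%:R * d i.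
  under eq_bigr => z _ do rewrite big_distrl.
  rewrite exchange_big /=.
  under eq_bigr => j _ do
    (under eq_bigr => z _ do
       rewrite -mulrA (walsh_charC z j) (walsh_charC z i);
     rewrite -big_distrr /= walsh_orth).
  rewrite (bigD1 i) //= eqxx mulr1 big1 ?addr0 1?mulrC //.
  by move=> j /negPf ->; rewrite !mulr0.
apply: (mulfI (pow2_neq0 (2 * k))); rewrite -!F.
by apply: eq_bigr => z _; rewrite E.
Qed.

Definition walsh_coef (k : nat) (g : 'I_(2 ^ k) -> 'I_(2 ^ k) -> R) :
    {ffun 'I_(2 ^ (2 * k)) -> R} :=
  xchoose (walsh_expansion_exists g).

Lemma walsh_coefP k (g : 'I_(2 ^ k) -> 'I_(2 ^ k) -> R) :
  walsh_expansion g (walsh_coef g).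
Proof. exact: xchooseP. Qed.

(* The constant term [j = 0] is counted when it is nonzero. *)
Definition walsh_nterms (k : nat) (g : 'I_(2 ^ k) -> 'I_(2 ^ k) -> R) : nat :=
  #|[set j | walsh_coef g j != 0]|.

(* The subtraction is exact: [0 < popcount j] whenever [j != 0]. *)
Definition cx_cost (k : nat) (g : 'I_(2 ^ k) -> 'I_(2 ^ k) -> R) : nat :=
  (\sum_(j < 2 ^ (2 * k) | (0 < j) && (walsh_coef g j != 0%R))
     2 * (popcount j - 1))%N.

End Walsh.

Arguments manhattan : clear implicits.
Arguments ext_dist : clear implicits.

(* Main.v *)
(* The distance |x - y| of two w-bit numbers is decided at their highest
   differing bit: with s and t the signs (-1)^bit of the top bits, the distance
   is (1 + s t) / 2 times the distance of the lower parts, plus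
   2^w (1 - s t) / 2, plus (t - s) / 2 times the (signed) difference of the
   lower parts, which has only 2 w Walsh terms. Hence the number of Walsh terms
   satisfies N(w+1) <= 2 N(w) + 4 w + 2, which gives O(2^w). Each term costs at
   most 4 k since an index has at most 2 k set bits. *)
Require Import Defs.
From Stdlib Require PeanoNat.
From HB Require Import structures.
From mathcomp Require Import all_boot all_order all_algebra.
From mathcomp Require Import reals.
From mathcomp Require Import zify ring lra.

Set Implicit Arguments.
Unset Strict Implicit.
Unset Printing Implicit Defensive.

Import Order.TTheory GRing.Theory Num.Theory.

Local Open Scope ring_scope.

(** * Binary values and the bits of labels *)

Definition binval (w : nat) (b : nat -> bool) : nat :=
  (\sum_(i < w) b i * 2 ^ i)%N.

Lemma binvalS w b : binval w.+1 b = (binval w b + b w * 2 ^ w)%N.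
Proof. exact: big_ord_recr. Qed.

Lemma ltn_binval w b : (binval w b < 2 ^ w)%N.
Proof.
elim: w => [|w IH]; first by rewrite /binval big_ord0.
rewrite binvalS expnS mul2n -addnn -addSn leq_add //.
by case: (b w); rewrite ?mul1n.
Qed.

Lemma eq_binval w b b' :
  (forall i, (i < w)%N -> b i = b' i) -> binval w b = binval w b'.
Proof. by move=> E; apply: eq_bigr => i _; rewrite E. Qed.

(** Row-major order is Euclidean division by [2 ^ kx]: the low bits form a number below [2 ^ kx],
    hence the remainder, and the high bits form the quotient. *)
Lemma label_pointE kx ky s : (s < 2 ^ (kx + ky))%N ->
  label_point kx ky s = site_point kx s.
Proof.
move=> /coords_label E; rewrite /label_point /site_point.
have hx : (xcoord kx s < 2 ^ kx)%N := ltn_binval kx (bit s).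
rewrite {3 4}E addnC mulnC modnMDl divnMDl ?expn_gt0 //.
by rewrite modn_small // divn_small // addn0.
Qed.

Lemma bit_modn j n i : (i < n)%N -> bit (j %% 2 ^ n) i = bit j i.
Proof.
move=> hi; rewrite !bitE {2}(divn_eq j (2 ^ n)).
(* After division by [2 ^ i], the quotient part is a multiple of [2 ^ (n - i)], which is even as
   [i < n]. *)
have -> : (2 ^ n = 2 ^ (n - i) * 2 ^ i)%N by rewrite -expnD subnK // ltnW.
rewrite mulnA divnMDl ?expn_gt0 // oddD oddM oddX /=.
by rewrite subn_eq0 leqNgt hi andbF.
Qed.

Lemma bit_pow2 n i : bit (2 ^ n) i = (i == n).
Proof.
rewrite bitE; case: (ltngtP i n) => [lt_in|lt_ni|->].
- by rewrite -(expnB _ (ltnW lt_in)) // oddX subn_eq0 leqNgt lt_in.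
- by rewrite divn_small // ltn_exp2l.
- by rewrite divnn expn_gt0.
Qed.

Lemma bit_merge_low k s t i : (s < 2 ^ k)%N -> (i < k)%N ->
  bit (s + 2 ^ k * t) i = bit s i.
Proof.
move=> hs hi; rewrite -(bit_modn _ hi) addnC mulnC modnMDl.
by rewrite modn_small.
Qed.

Lemma bit_merge_high k s t i : (s < 2 ^ k)%N ->
  bit (s + 2 ^ k * t) (k + i) = bit t i.
Proof.
move=> hs; rewrite !bitE expnD divnMA addnC mulnC.
by rewrite divnMDl ?expn_gt0 // (divn_small hs) addn0.
Qed.

(** * Walsh characters and their products *)

Lemma walsh_char_sum (R : realType) n z j :
    (forall i, (n <= i)%N -> bit z i && bit j i = false) ->
  walsh_char R z j = (-1) ^+ (\sum_(i < n) (bit z i && bit j i))%N.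
Proof.
move=> h; rewrite /walsh_char (@popcount_sum _ n); last first.
  by move=> i hi; rewrite bit_land h.
by congr (_ ^+ _); apply: eq_bigr => i _; rewrite bit_land.
Qed.

(** Over a common range of bits both sides are products of signs, and they agree bit by bit. *)
Lemma walsh_charM (R : realType) z j j' :
  walsh_char R z j * walsh_char R z j' = walsh_char R z (Nat.lxor j j').
Proof.
pose n := maxn j j'.
have small a i : (a <= n)%N -> (n <= i)%N -> bit a i = false.
  move=> an ni; apply: (@bit_small _ a); last exact: leq_trans ni.
  exact: ltn_expl.
have xorE i : bit (Nat.lxor j j') i = bit j i (+) bit j' i.
  by rewrite /bit PeanoNat.Nat.lxor_spec; case: (Nat.testbit j i); case: (Nat.testbit j' i).
rewrite !(@walsh_char_sum _ n) => [|i ni|i ni|i ni].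
- rewrite !expr_sum -big_split; apply: eq_bigr => i _ /=.
  by rewrite xorE; case: (bit z i); case: (bit j i); case: (bit j' i);
    rewrite ?expr0 ?expr1 ?mulr1 ?mul1r ?mulrNN ?mulr1.
- by rewrite xorE (small j) ?(small j') ?andbF ?leq_maxl ?leq_maxr.
- by rewrite (small j') ?andbF ?leq_maxr.
- by rewrite (small j) ?andbF ?leq_maxl.
Qed.

Lemma walsh_char0 (R : realType) z : walsh_char R z 0 = 1.
Proof.
rewrite (@walsh_char_sum _ 0) ?big_ord0 // => i _.
by rewrite [bit 0 i]bitE div0n andbF.
Qed.

Lemma walsh_char_pow2 (R : realType) z i :
  walsh_char R z (2 ^ i) = (-1) ^+ bit z i.
Proof.
rewrite (@walsh_char_sum _ i.+1) => [|l hl]; last first.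
  by rewrite bit_pow2 gtn_eqF ?andbF.
rewrite big_ord_recr big1 /= => [|l _]; last first.
  by rewrite bit_pow2 ltn_eqF ?andbF.
by rewrite bit_pow2 eqxx andbT.
Qed.

Lemma walsh_char_modn (R : realType) n z j : (z < 2 ^ n)%N ->
  walsh_char R z (j %% 2 ^ n) = walsh_char R z j.
Proof.
move=> hz; rewrite !(@walsh_char_sum _ n) => [|i ni|i ni]; last first.
- by rewrite (bit_small hz).
- by rewrite (bit_small hz).
by congr (_ ^+ _); apply: eq_bigr => i _; rewrite bit_modn.
Qed.

(** * Functions that are sums of few Walsh terms *)

(** The list may repeat indices, and the indices are unbounded, so sums are concatenations and
    products with characters act entrywise. Merging and reduction of indices wait until
    [walsh_nterms_sparse]. *)
Definition walsh_sparse (R : realType) (N : nat) (F : nat -> R) : Prop :=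
  exists2 L : seq (R * nat), (size L <= N)%N &
    forall z, F z = \sum_(p <- L) p.1 * walsh_char R z p.2.

Lemma walsh_sparse_ext (R : realType) N (F G : nat -> R) :
  (forall z, F z = G z) -> walsh_sparse N F -> walsh_sparse N G.
Proof. by move=> E [L hL hF]; exists L => // z; rewrite -E hF. Qed.

Lemma walsh_sparse_leq (R : realType) N N' (F : nat -> R) :
  (N <= N')%N -> walsh_sparse N F -> walsh_sparse N' F.
Proof. by move=> hN [L hL hF]; exists L => //; apply: leq_trans hN. Qed.

Lemma walsh_sparse0 (R : realType) : walsh_sparse 0 (fun=> 0 : R).
Proof. by exists [::] => // z; rewrite big_nil. Qed.

Lemma walsh_sparse_cst (R : realType) (a : R) : walsh_sparse 1 (fun=> a).
Proof.
by exists [:: (a, 0%N)] => // z; rewrite big_seq1 walsh_char0 mulr1.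
Qed.

Lemma walsh_sparseD (R : realType) N N' (F G : nat -> R) :
  walsh_sparse N F -> walsh_sparse N' G ->
  walsh_sparse (N + N') (fun z => F z + G z).
Proof.
move=> [L hL hF] [L' hL' hG]; exists (L ++ L').
  by rewrite size_cat leq_add.
by move=> z; rewrite big_cat hF hG.
Qed.

Lemma walsh_sparseM (R : realType) N (a : R) j (F : nat -> R) :
  walsh_sparse N F -> walsh_sparse N (fun z => a * walsh_char R z j * F z).
Proof.
move=> [L hL hF]; exists [seq (a * p.1, Nat.lxor j p.2) | p <- L].
  by rewrite size_map.
move=> z; rewrite hF big_map big_distrr; apply: eq_bigr => p _ /=.
by rewrite -walsh_charM mulrACA.
Qed.

Lemma walsh_sparseZ (R : realType) N (a : R) (F : nat -> R) :
  walsh_sparse N F -> walsh_sparse N (fun z => a * F z).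
Proof.
move=> /(walsh_sparseM a 0); apply: walsh_sparse_ext => z.
by rewrite walsh_char0 mulr1.
Qed.

Lemma bitR (R : realType) z i :
  (bit z i)%:R = 2^-1 * (1 - walsh_char R z (2 ^ i)).
Proof.
rewrite walsh_char_pow2; case: bit => /=; rewrite ?expr0 ?expr1.
  by rewrite opprK mulVf // pnatr_eq0.
by rewrite subrr mulr0.
Qed.

(** Each bit is half of one minus a character. The constants cancel in the difference, which leaves
    two terms per bit position. The maps [u] and [v] say where in [z] the two numbers are stored. *)
Lemma walsh_sparse_sub (R : realType) (u v : nat -> nat) w :
  walsh_sparse (2 * w) (fun z =>
    (binval w (fun i => bit z (u i)))%:R -
    (binval w (fun i => bit z (v i)))%:R : R).
Proof.
elim: w => [|w IH].
  apply: walsh_sparse_ext (walsh_sparse0 R) => z.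
  by rewrite /binval !big_ord0 subrr.
rewrite mulnS addnC; pose a : R := 2^-1 * 2 ^+ w.
have := walsh_sparseD IH (walsh_sparseD
  (walsh_sparseM (- a) (2 ^ u w) (walsh_sparse_cst 1))
  (walsh_sparseM a (2 ^ v w) (walsh_sparse_cst 1))).
apply: walsh_sparse_ext => z.
by rewrite !binvalS !natrD !natrM !bitR natrX /a; ring.
Qed.

(** Equal top bits cancel. If they differ, the lower parts, being below [2 ^ w], cannot change the
    sign, so the absolute value opens to a linear expression. *)
Lemma dist_binvalS (R : realType) w (b c : nat -> bool) :
  let D : R := (binval w b)%:R - (binval w c)%:R in
  let s : R := (-1) ^+ b w in let t : R := (-1) ^+ c w in
  `|(binval w.+1 b)%:R - (binval w.+1 c)%:R| =
    2^-1 * (1 + s * t) * `|D| + 2^-1 * 2 ^+ w * (1 - s * t) +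
    2^-1 * (t - s) * D.
Proof.
rewrite /= !binvalS !natrD !natrM natrX.
have lt d : (binval w d)%:R < 2 ^+ w :> R by rewrite -natrX ltr_nat ltn_binval.
have := lt b; have := lt c.
have : 0 <= (binval w b)%:R :> R by [].
have : 0 <= (binval w c)%:R :> R by [].
move: (binval w b)%:R (binval w c)%:R => X Y Y0 X0 hY hX.
case: (b w); case: (c w); rewrite /= ?expr0 ?expr1 ?mul1r ?mul0r ?addr0.
- rewrite (_ : X + _ - _ = X - Y); last by ring.
  by field.
- by rewrite ger0_norm; [field | lra].
- by rewrite ler0_norm; [field | lra].
- by field.
Qed.

(* N(w+1) = 2 N(w) + 4 w + 2 with N(0) = 0 solves to 6 * 2 ^ w - 4 w - 6. *)
Lemma walsh_sparse_dist (R : realType) (u v : nat -> nat) w :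
  walsh_sparse (6 * 2 ^ w - (4 * w + 6)) (fun z =>
    `|(binval w (fun i => bit z (u i)))%:R -
      (binval w (fun i => bit z (v i)))%:R| : R).
Proof.
elim: w => [|w IH].
  apply: walsh_sparse_ext (walsh_sparse0 R) => z.
  by rewrite /binval !big_ord0 subrr normr0.
set F := (fun z : nat => _) in IH.
pose G (z : nat) : R := (binval w (fun i => bit z (u i)))%:R -
  (binval w (fun i => bit z (v i)))%:R.
have hG : walsh_sparse (2 * w) G := walsh_sparse_sub R u v w.
(* The index of the product of the two top signs. *)
pose j := Nat.lxor (2 ^ u w) (2 ^ v w).
pose a : R := 2^-1 * 2 ^+ w.
have := walsh_sparseD (walsh_sparseD
   (walsh_sparseD (walsh_sparseZ 2^-1 IH) (walsh_sparseM 2^-1 j IH))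
   (walsh_sparseD (walsh_sparse_cst a)
      (walsh_sparseM (- a) j (walsh_sparse_cst 1))))
  (walsh_sparseD (walsh_sparseM 2^-1 (2 ^ v w) hG)
     (walsh_sparseM (- 2^-1) (2 ^ u w) hG)).
move/(@walsh_sparse_leq _ _ (6 * 2 ^ w.+1 - (4 * w.+1 + 6))) => H.
apply: walsh_sparse_ext (H _) => [z|].
  rewrite dist_binvalS -walsh_charM !walsh_char_pow2 -/(G z) -/(F z) /a.
  by ring.
(* This keeps the truncated subtraction in the bound exact. *)
have : (w.+1 <= 2 ^ w)%N by apply: ltn_expl.
by rewrite expnS; lia.
Qed.

(** * Counting nonzero coefficients and CX gates *)

Lemma walsh_nterms_sparse (R : realType) k (g : 'I_(2 ^ k) -> 'I_(2 ^ k) -> R)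
    N (F : nat -> R) :
  (forall s t, g s t = F (s + 2 ^ k * t)%N) -> walsh_sparse N F ->
  (walsh_nterms g <= N)%N.
Proof.
move=> gF [L hL hF].
have q_gt0 : (0 < 2 ^ (2 * k))%N by rewrite expn_gt0.
(* Arguments have only [2 * k] bits, so higher bits of an index do not matter. Adding the
   coefficients of equal residues gives an expansion, the Walsh one by uniqueness, supported on
   residues from the list. *)
pose idx (p : R * nat) : 'I_(2 ^ (2 * k)) := Ordinal (ltn_pmod p.2 q_gt0).
pose c := [ffun j => \sum_(p <- L | idx p == j) p.1].
have hc : walsh_expansion g c.
  apply/forallP => s; apply/forallP => t; apply/eqP.
  have hz : (s + 2 ^ k * t < 2 ^ (2 * k))%N.
    have hs := ltn_ord s; have ht := ltn_ord t.
    by rewrite mul2n -addnn expnD; nia.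
  rewrite gF hF; set z := (s + _)%N in hz *.
  under eq_bigr => p _ do rewrite -(walsh_char_modn _ p.2 hz).
  rewrite (partition_big idx predT) //=; apply: eq_bigr => j _.
  by rewrite ffunE big_distrl; apply: eq_bigr => p /eqP <-.
rewrite /walsh_nterms (walsh_expansion_uniq (walsh_coefP g) hc).
apply: leq_trans hL; rewrite -(size_map idx).
apply: leq_trans (card_size _); apply/subset_leq_card/subsetP => j.
rewrite inE ffunE => nz; apply: contraNT nz => notin; apply/eqP.
rewrite big_seq_cond big1 // => p /andP[pL /eqP pj].
by case/negP: notin; apply/mapP; exists p.
Qed.

Lemma leq_popcount n j : (j < 2 ^ n)%N -> (popcount j <= n)%N.
Proof.
move=> hj; rewrite (@popcount_sum _ n) => [|i ni]; last exact: bit_small ni.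
apply: (@leq_trans (\sum_(i < n) 1)%N); last by rewrite sum1_card card_ord.
by apply: leq_sum => i _; case: bit.
Qed.

Lemma cx_cost_nterms (R : realType) k (g : 'I_(2 ^ k) -> 'I_(2 ^ k) -> R) :
  (cx_cost g <= 4 * k * walsh_nterms g)%N.
Proof.
rewrite /cx_cost /walsh_nterms [leqRHS]mulnC -sum_nat_const.
rewrite big_mkcond [leqRHS]big_mkcond leq_sum // => j _ /=.
rewrite inE; case: ifP => // /andP[_ ->].
by have := leq_popcount (ltn_ord j); lia.
Qed.

Lemma ext_dist_nterms (R : realType) kx ky :
  (walsh_nterms (ext_dist R kx ky) <= 6 * (2 ^ kx + 2 ^ ky))%N.
Proof.
pose k := (kx + ky)%N.
(* In [s + 2 ^ k * t] the bits of [s] start at position 0 and those of [t] at [k]; within each label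
   the row bits start at [kx]. *)
have := walsh_sparseD (walsh_sparse_dist R id (addn k) kx)
  (walsh_sparse_dist R (addn kx) (fun i => k + (kx + i))%N ky).
move/(@walsh_nterms_sparse _ _ (ext_dist R kx ky)) => H.
apply: leq_trans (H _) _; last by lia.
have xE u : xcoord kx u = binval kx (bit u) by [].
have yE u : ycoord kx ky u = binval ky (fun i => bit u (kx + i)) by [].
move=> s t; rewrite /ext_dist /manhattan /label_point /= !xE !yE.
congr (`|_%:R - _%:R| + `|_%:R - _%:R|); apply: eq_binval => i hi.
- by rewrite bit_merge_low // ltn_addr.
- by rewrite bit_merge_high.
- by rewrite bit_merge_low // ltn_add2l.
- by rewrite bit_merge_high.
Qed.

(** After squaring, this is [2 * a <= 2 + (a + b)] for the exponents of 2. *)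
Lemma pow2_le_sqrt (R : realType) a b : (a <= b + 1)%N ->
  2 ^+ a <= 2 * Num.sqrt (2 ^ (a + b))%:R :> R.
Proof.
move=> hab; rewrite -ler_sqr ?nnegrE ?mulr_ge0 ?sqrtr_ge0 ?exprn_ge0 //.
rewrite exprMn sqr_sqrtr ?ler0n // natrX -exprM -exprD.
by rewrite ler_eXn2l ?ltr1n //; lia.
Qed.

Theorem mainTheorem3 (R : realType) :
  exists C : R, forall (kx ky m : nat) (k_gt0 : (1 <= kx + ky)%N)
      (m_le : (m <= 2 ^ (kx + ky))%N),
    [/\ forall s t : 'I_m,
          ext_dist R kx ky (widen_ord m_le s) (widen_ord m_le t) =
          manhattan R (site_point kx s) (site_point kx t),
        (walsh_nterms (ext_dist R kx ky))%:R <= C * (2 ^+ kx + 2 ^+ ky),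
        (cx_cost (ext_dist R kx ky))%:R <=
          C * ((kx + ky)%:R * (2 ^+ kx + 2 ^+ ky))
      & m = (2 ^ (kx + ky))%N -> (kx <= ky + 1)%N -> (ky <= kx + 1)%N ->
          (walsh_nterms (ext_dist R kx ky))%:R <= C * Num.sqrt m%:R /\
          (cx_cost (ext_dist R kx ky))%:R <=
            C * ((kx + ky)%:R * Num.sqrt m%:R)].
Proof.
(* The factors are 6 for the number of terms, 4 for the cost per term divided by [k], and 4 for
   bounding [2 ^+ kx + 2 ^+ ky] by the square root of [m]. *)
exists 96 => kx ky m _ m_le.
have hN := ext_dist_nterms R kx ky.
have hT := cx_cost_nterms (ext_dist R kx ky).
move: (walsh_nterms _) (cx_cost _) hN hT => N T hN hT.
have {}hN : N%:R <= 6 * (2 ^+ kx + 2 ^+ ky) :> R.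
  by rewrite -!natrX -natrD -natrM ler_nat.
have {}hT : T%:R <= 4 * ((kx + ky)%:R * N%:R) :> R.
  by rewrite -!natrM ler_nat mulnA.
have k0 : 0 <= (kx + ky)%:R :> R by [].
have {}hT : T%:R <= 24 * ((kx + ky)%:R * (2 ^+ kx + 2 ^+ ky)) :> R.
  by have := ler_wpM2l k0 hN; lra.
have x0 : 0 <= 2 ^+ kx :> R by rewrite exprn_ge0.
have y0 : 0 <= 2 ^+ ky :> R by rewrite exprn_ge0.
split=> [s t|||em hxy hyx].
- by rewrite /ext_dist !label_pointE //= (leq_trans (ltn_ord _) m_le).
- by lra.
- by have := mulr_ge0 k0 (addr_ge0 x0 y0); lra.
have hx := pow2_le_sqrt R hxy; have := pow2_le_sqrt R hyx.
rewrite [(ky + kx)%N]addnC -em in hx * => hy.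
have hxy4 : 2 ^+ kx + 2 ^+ ky <= 4 * Num.sqrt m%:R :> R by lra.
split; first by lra.
by have := ler_wpM2l k0 hxy4; lra.
Qed.
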